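(* Let $R$ be a finite commutative chain ring which is not a field, let $\theta\in R$ be a generator of the maximal ideal of $R$, let $R/R\theta\cong\mathbb{F}_q$ and $|R|=q^m$ (so $m\ge 2$), and let $I=R\theta^{m-1}$ be the minimal ideal of $R$. Let $\alpha\in R$ with $\alpha^2=1$, let $k$ be a positive integer, and write $\bar{\ }:R\to R/I$ for the canonical projection. Let $e:R/I\to R$ be a map sending each element of $R/I$ to a representative in $R$, with $e(\bar\alpha)=\alpha$. Let $a=(a_0,\ldots,a_{k-1})\in (R/I)^k$ be such that, with $A=\operatorname{circ}_{\bar\alpha}(a)$, the code over $R/I$ generated by $(I_k\mid A)$ is self-dual. Define $$c_0 = 1+\sum_{i=0}^{k-1} e(a_i)^2,\qquad c_j=\sum_{i=0}^{j-1}\alpha\, e(a_i)e(a_{k-j+i})+\sum_{i=j}^{k-1}e(a_i)e(a_{i-j})\quad\text{for } j\in\{1,\ldots,\lfloor k/2\rfloor\}.$$ Then $c_j\in I$ for all $j\in\{0,\ldots,\lfloor k/2\rfloor\}$, and for every $w=(w_0,\ldots,w_{k-1})\in I^k$ (the $k$-fold Cartesian product of $I$), the lift $B=\operatorname{circ}_\alpha(e(a))+\operatorname{circ}_\alpha(w)$ of $A$ has the property that the code over $R$ generated by $(I_k\mid B)$ is self-dual if and only if $$0=c_0+2\sum_{i=0}^{k-1}e(a_i)w_i$$ and, for all $j\in\{1,\ldots,\lfloor k/2\rfloor\}$, $$0=c_j+\sum_{i=0}^{j-1}\bigl(\alpha\, e(a_i)w_{k-j+i}+\alpha\, e(a_{k-j+i})w_i\bigr)+\sum_{i=j}^{k-1}\bigl(e(a_i)w_{i-j}+e(a_{i-j})w_i\bigr).$$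 This is an $R$-linear system of equations for the components $w_i\in I$; since $I\cong R/R\theta$ as $R$-modules and $R/R\theta\cong\mathbb{F}_q$, it can be reformulated as a linear system of equations over the finite field $\mathbb{F}_q$.
   Context: A chain ring is a ring whose left ideals are linearly ordered by inclusion. For a commutative ring $S$, $\alpha\in S$ and $v=(v_0,\ldots,v_{k-1})\in S^k$, $\operatorname{circ}_\alpha(v)$ denotes the $\alpha$-circulant $k\times k$ matrix with first row $v$; with rows and columns indexed from $0$, its $(i,j)$ entry is $v_{j-i}$ if $j\ge i$ and $\alpha v_{k+j-i}$ if $j<i$. $I_k$ is the $k\times k$ identity matrix. For $a\in(R/I)^k$, $e(a)=(e(a_0),\ldots,e(a_{k-1}))$. A lift of an $\bar\alpha$-circulant matrix $A$ over $R/I$ is an $\alpha$-circulant matrix $B$ over $R$ whose entrywise reduction modulo $I$ equals $A$. The code generated by a matrix is the submodule spanned by its rows; a code $C\subseteq S^n$ is self-dual if it equals its dual $\{x\in S^n:\langle x,c\rangle=0\text{ for all }c\in C\}$ with respect to the standard inner product $\langle x,y\rangle=\sum_i x_iy_i$. *)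

(* Defs.v *)
From HB Require Import structures.
From mathcomp Require Import all_boot all_order all_algebra.

Set Implicit Arguments.
Unset Strict Implicit.
Unset Printing Implicit Defensive.

Import GRing.Theory.
Local Open Scope ring_scope.
Local Open Scope quotient_scope.

Section Ideals.

Variable R : finComUnitRingType.

(* An ideal of R is a submodule of the regular module R^o.  Since R is finite,
   boolean predicates represent all of its subsets. *)
Definition is_ideal (J : {pred R}) : Prop :=
  GRing.submod_closed (J : {pred R^o}).

Definition chain_ring : Prop :=
  forall J K : {pred R}, is_ideal J -> is_ideal K ->
    {subset J <= K} \/ {subset K <= J}.

Definition principal (x : R) : {pred R} := [pred y | [exists r, y == r * x]].

Definition maximal_ideal (J : {pred R}) : Prop :=
  [/\ is_ideal J, ~ J =i predT
    & forall K : {pred R}, is_ideal K -> {subset J <= K} ->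
        K =i J \/ K =i predT].

Definition minimal_ideal (J : {pred R}) : Prop :=
  [/\ is_ideal J, ~ J =i pred1 0
    & forall K : {pred R}, is_ideal K -> {subset K <= J} ->
        K =i pred1 0 \/ K =i J].

(* phi is only relevant on J: it restricts to an isomorphism of R-modules from
   J onto R / M, where r : R acts on R / M as multiplication by its class. *)
Definition module_iso (J : {pred R}) (M : idealr R)
    (phi : R -> {ideal_quot M}) : Prop :=
  [/\ {in J &, forall x y, phi (x + y) = phi x + phi y},
      forall r : R, {in J, forall x, phi (r * x) = \pi_{ideal_quot M} r * phi x},
      {in J &, injective phi}
    & forall y : {ideal_quot M}, exists2 x, x \in J & phi x = y].

End Ideals.

Section Circulant.

Variables (S : comNzRingType) (k : nat).

(* The default value 0 of v`_n, for n >= k, is never used here. *)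
Definition circ (alpha : S) (v : k.-tuple S) : 'M[S]_k :=
  \matrix_(i < k, j < k)
    (if (i <= j)%N then v`_(j - i) else alpha * v`_(k + j - i)).

End Circulant.

Definition is_lift (R : finComUnitRingType) (I : idealr R) (alpha : R) (k : nat)
    (A : 'M[{ideal_quot I}]_k) (B : 'M[R]_k) : Prop :=
  (exists v : k.-tuple R, B = circ alpha v) /\
  map_mx (\pi_{ideal_quot I}) B = A.

Section Codes.

Variables (S : comNzRingType) (n : nat).

Definition inner (x y : 'rV[S]_n) : S := \sum_(i < n) x 0 i * y 0 i.

(* u *m G is the combination of the rows of G with coefficients u. *)
Definition code_gen (k : nat) (G : 'M[S]_(k, n)) : 'rV[S]_n -> Prop :=
  fun x => exists u : 'rV[S]_k, x = u *m G.

Definition dual (C : 'rV[S]_n -> Prop) : 'rV[S]_n -> Prop :=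
  fun x => forall c, C c -> inner x c = 0.

Definition self_dual (C : 'rV[S]_n -> Prop) : Prop :=
  forall x, C x <-> dual C x.

End Codes.

Section System.

Variables (R : comNzRingType) (k : nat) (alpha : R).

(* The constants c_j, with v = e(a). *)
Definition sys_const (v : k.-tuple R) (j : nat) : R :=
  if j == 0%N then 1 + \sum_(0 <= i < k) v`_i ^+ 2
  else \sum_(0 <= i < j) alpha * v`_i * v`_(k - j + i)
       + \sum_(j <= i < k) v`_i * v`_(i - j).

(* The right-hand side of the j-th equation for w, with v = e(a). *)
Definition sys_rhs (v w : k.-tuple R) (j : nat) : R :=
  if j == 0%N then sys_const v 0 + 2%:R * \sum_(0 <= i < k) v`_i * w`_i
  else sys_const v j
       + \sum_(0 <= i < j) (alpha * v`_i * w`_(k - j + i)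
                            + alpha * v`_(k - j + i) * w`_i)
       + \sum_(j <= i < k) (v`_i * w`_(i - j) + v`_(i - j) * w`_i).

Definition sys_holds (v w : k.-tuple R) : Prop :=
  forall j, (j <= k./2)%N -> 0 = sys_rhs v w j.

End System.

(* Main.v *)
(** The code generated by (1 | B) is self-dual iff 1 + B B^T = 0.  For an
    alpha-circulant B with alpha^2 = 1, the entry (i, j) of B B^T is unchanged
    when both indices are shifted by one, so that 1 + B B^T is symmetric and
    alpha-circulant, hence determined by its entries (0, j) with j <= k / 2:
    these are the sys_const.  Over R / I they vanish, so over R they
    lie in I.  Since I * I = 0, replacing e(a) by e(a) + w only adds the
    terms linear in w.

    For the ring, R theta^i / R theta^(i+1) has q elements as long as
    theta^i <> 0, so that |R| = q^m forces theta^(m-1) <> 0 = theta^m; hence I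
    is the socle and r theta^(m-1) |-> r mod R theta is an isomorphism. *)

Require Import Defs.
From HB Require Import structures.
From mathcomp Require Import all_boot all_order all_algebra.
From mathcomp Require Import zify ring.

Set Implicit Arguments.
Unset Strict Implicit.
Unset Printing Implicit Defensive.

Import GRing.Theory.
Local Open Scope ring_scope.
Local Open Scope quotient_scope.

(** * Self-duality of codes with a systematic generator matrix *)

Lemma innerE (S : comNzRingType) n (x y : 'rV[S]_n) :
  inner x y = (x *m y^T) 0 0.
Proof. by rewrite mxE; apply: eq_bigr => i _; rewrite mxE. Qed.

Lemma dual_code_gen (S : comNzRingType) k n (G : 'M[S]_(k, n)) (x : 'rV[S]_n) :
  dual (code_gen G) x <-> x *m G^T = 0.
Proof.
split=> [dx | xG c [u ->]].
  apply/rowP=> i; have := dx (row i G).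
  rewrite innerE tr_row colE mulmxA -colE mxE => ->; first by rewrite mxE.
  by exists (delta_mx 0 i); rewrite rowE.
by rewrite innerE trmx_mul mulmxA xG mul0mx mxE.
Qed.

(** For [G = (1 | B)], [G G^T = 1 + B B^T], so this sum vanishes exactly when the code lies in its
    dual. Then the dual also lies in the code: if [(u | v)] is orthogonal to the rows,
    [u + v B^T = 0], and multiplying by [B] with [B^T B = -1] gives [v = u B]. *)
Lemma self_dual_systematic (S : comNzRingType) k (B : 'M[S]_k) :
  self_dual (code_gen (row_mx 1%:M B)) <-> 1%:M + B *m B^T = 0.
Proof.
set G := row_mx 1%:M B.
have GGt : G *m G^T = 1%:M + B *m B^T.
  by rewrite tr_row_mx mul_row_col trmx1 mulmx1.
split=> [sd | BBt x].
  rewrite -GGt; apply/row_matrixP=> i; rewrite row_mul row0.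
  apply/dual_code_gen/sd; exists (delta_mx 0 i); exact: rowE.
rewrite dual_code_gen; split=> [[u ->] | ].
  by rewrite -mulmxA GGt BBt mulmx0.
(* [B] and [-B^T] are square and inverse on one side, hence on both. *)
have BtB : B^T *m B = - 1%:M.
  apply/eqP; rewrite -subr_eq0 opprK addrC -[B^T *m B]opprK -mulNmx subr_eq0.
  apply/eqP/esym/mulmx1C; rewrite mulmxN; apply/eqP.
  by rewrite -subr_eq0 -opprD oppr_eq0 addrC BBt.
rewrite -[x]hsubmxK tr_row_mx mul_row_col trmx1 mulmx1.
move: (lsubmx x) (rsubmx x) => u v uv.
have -> : v = u *m B.
  apply/eqP; rewrite -subr_eq0 -opprB oppr_eq0; apply/eqP.
  by rewrite -[RHS](mul0mx _ B) -uv mulmxDl -mulmxA BtB mulmxN mulmx1.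
by exists u; rewrite mul_mx_row mulmx1.
Qed.

(** * Inner products of the rows of an alpha-circulant matrix *)

Section CirculantGram.

Variables (S : comNzRingType) (k : nat) (alpha : S) (v : k.-tuple S).

(* The row index may take the value k: row k is alpha times row 0. *)
Definition circ_entry (i l : nat) : S :=
  if (i <= l)%N then v`_(l - i) else alpha * v`_(k + l - i).

Definition circ_gram (i j : nat) : S :=
  \sum_(0 <= l < k) circ_entry i l * circ_entry j l.

Lemma circ_gramC i j : circ_gram i j = circ_gram j i.
Proof. by apply: eq_bigr => l _; rewrite mulrC. Qed.

Lemma circ_mul_tr (i j : 'I_k) :
  (circ alpha v *m (circ alpha v)^T) i j = circ_gram i j.
Proof.
by rewrite /circ_gram big_mkord mxE; apply: eq_bigr => l _; rewrite !mxE.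
Qed.

Lemma circ_gram_rowk j : circ_gram k j = alpha * circ_gram 0 j.
Proof.
rewrite /circ_gram mulr_sumr; apply: eq_big_nat => l /andP[_ lk].
by rewrite /circ_entry leq0n subn0 (leqNgt k) lk /= addKn mulrA.
Qed.

Lemma sys_constE j : (j <= k)%N ->
  sys_const alpha v j = (j == 0%N)%:R + circ_gram 0 j.
Proof.
rewrite /sys_const /circ_gram; case: (j =P 0%N) => [-> _ | _ jk].
  by congr (_ + _); apply: eq_bigr => l _; rewrite /circ_entry subn0 expr2.
(* Row [j] wraps around, and so carries the factor [alpha], exactly in the columns [l < j]. *)
rewrite add0r [RHS](big_cat_nat (n := j)) //=; congr (_ + _).
  apply: eq_big_nat => l /andP[_ lj]; rewrite /circ_entry (leqNgt j) lj subn0 /=.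
  by rewrite mulrCA mulrA addnBAC // ltnW.
by apply: eq_big_nat => l /andP[jl _]; rewrite /circ_entry jl subn0.
Qed.

Hypothesis alpha2 : alpha ^+ 2 = 1.

(** Column [l + 1] of the shifted rows is column [l] of the original ones, and their column 0 is
    [alpha] times the original last column. That column contributes [alpha ^+ 2 = 1] times the
    original product. *)
Lemma circ_gramSS i j : (i < k)%N -> (j < k)%N ->
  circ_gram i.+1 j.+1 = circ_gram i j.
Proof.
move=> ik jk; have kE : k.-1.+1 = k by case: (k) ik.
rewrite /circ_gram -[in index_iota 0 k]kE.
rewrite big_nat_recl // [RHS]big_nat_recr //= addrC; congr (_ + _).
  rewrite /circ_entry mulrACA -expr2 alpha2 mul1r -[(i <= _)%N]ltnS.
  rewrite -[(j <= _)%N]ltnS kE ik jk !addn0 -[(k.-1 - i)%N]subSS.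
  by rewrite -[(k.-1 - j)%N]subSS kE.
by apply: eq_bigr => l _; rewrite /circ_entry !ltnS !subSS !addnS !subSS.
Qed.

Lemma circ_gramDD n i j : (i + n <= k)%N -> (j + n <= k)%N ->
  circ_gram (i + n) (j + n) = circ_gram i j.
Proof.
elim: n => [|n IHn]; first by rewrite !addn0.
by rewrite !addnS => ik jk; rewrite circ_gramSS // IHn // ltnW.
Qed.

Lemma circ_gram_sub i j : (i <= j <= k)%N -> circ_gram i j = circ_gram 0 (j - i).
Proof.
move=> /andP[ij jk]; rewrite -[RHS](@circ_gramDD i) ?add0n ?subnK //.
exact: leq_trans jk.
Qed.

(** Shifting by [j] turns the pair of rows [(0, k - j)] into [(j, k)], and row [k] is [alpha] times
    row 0. *)
Lemma circ_gram_compl j : (j <= k)%N ->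
  circ_gram 0 (k - j) = alpha * circ_gram 0 j.
Proof.
by move=> jk; rewrite -circ_gram_sub ?jk //= circ_gramC circ_gram_rowk.
Qed.

Lemma self_dual_circ : (0 < k)%N ->
  self_dual (code_gen (row_mx 1%:M (circ alpha v))) <->
  (forall j, (j <= k./2)%N -> sys_const alpha v j = 0).
Proof.
move=> k_gt0; rewrite self_dual_systematic; split=> [BBt j jk | const0].
  have jk' : (j < k)%N by lia.
  rewrite sys_constE; last exact: ltnW.
  have /matrixP/(_ (Ordinal k_gt0) (Ordinal jk')) := BBt.
  by rewrite [X in X = _]mxE circ_mul_tr !mxE eq_sym.
have row0 j : (0 < j < k)%N -> circ_gram 0 j = 0.
  move=> /andP[j_gt0 jk].
  have low i : (0 < i <= k./2)%N -> circ_gram 0 i = 0.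
    case/andP=> i_gt0 ik; have := const0 i ik.
    by rewrite sys_constE ?(gtn_eqF i_gt0) ?add0r //; lia.
  have [jh | hj] := leqP j k./2; first by rewrite low ?j_gt0.
  (* Above the middle, [j = k - (k - j)] with [k - j <= k./2]. *)
  rewrite -(subKn (ltnW jk)) circ_gram_compl ?leq_subr //.
  by rewrite low ?mulr0 //; lia.
have entry0 (i j : 'I_k) : (i <= j)%N ->
    (1%:M + circ alpha v *m (circ alpha v)^T) i j = 0.
  move=> ij; rewrite mxE circ_mul_tr mxE circ_gram_sub ?ij 1?ltnW //.
  have [<- | neq_ij] := eqVneq i j.
    by rewrite subnn -(const0 0) // sys_constE.
  rewrite add0r row0 // subn_gt0 ltn_neqAle ij andbT.
  by rewrite (leq_ltn_trans (leq_subr _ _)) ?ltn_ord // andbT.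
apply/matrixP=> i j; rewrite [RHS]mxE.
have [ij | /ltnW ji] := leqP i j; first exact: entry0.
rewrite -(entry0 _ _ ji) ![_ i j]mxE ![_ j i]mxE !circ_mul_tr circ_gramC.
by rewrite eq_sym.
Qed.

End CirculantGram.

(** * Principal ideals and units *)

Section PrincipalIdeals.

Variable R : finComUnitRingType.

Lemma principalP (x y : R) : reflect (exists r, y = r * x) (y \in principal x).
Proof. exact: 'exists_eqP. Qed.

Lemma mem_principal (r x : R) : r * x \in principal x.
Proof. by apply/principalP; exists r. Qed.

Lemma principal_ideal (x : R) : is_ideal (principal x).
Proof.
split=> [|c u v /principalP[r ->] /principalP[s ->]].
  by apply/principalP; exists 0; rewrite mul0r.
by apply/principalP; exists (c * r + s); rewrite -[c *: _]/(c * _) mulrDl mulrA.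
Qed.

Lemma is_idealMl (J : {pred R}) (r x : R) : is_ideal J -> x \in J -> r * x \in J.
Proof. by case=> J0 Jlin Jx; rewrite -[r * x]addr0; apply: (Jlin r x 0). Qed.

Lemma unit_in_ideal (J : {pred R}) (x : R) :
  is_ideal J -> x \in J -> x \is a GRing.unit -> J =i predT.
Proof.
by move=> idJ Jx Ux y; rewrite -(mulrVK Ux y) is_idealMl.
Qed.

(** In a chain ring [principal x] is comparable with [J]. If it contains [J], maximality makes it
    [J] or the whole ring, and the latter would make [x] a unit. *)
Lemma mem_maximal_ideal (J : {pred R}) (x : R) :
  chain_ring R -> maximal_ideal J -> (x \in J) = (x \isn't a GRing.unit).
Proof.
move=> chainR [idJ properJ maxJ]; apply/idP/idP=> [Jx | nUx].
  by apply/negP=> Ux; apply/properJ/(unit_in_ideal idJ Jx).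
have Xx : x \in principal x by rewrite -{1}[x]mul1r mem_principal.
have [sXJ | sJX] := chainR _ _ (principal_ideal x) idJ; first exact: sXJ.
have [<- // | X_all] := maxJ _ (principal_ideal x) sJX.
have /principalP[r rx] : 1 \in principal x by rewrite X_all.
case/negP: nUx; apply/unitrP; exists r.
by rewrite [x * r]mulrC -rx.
Qed.

End PrincipalIdeals.

Lemma pi_ideal_eq0 (R : comNzRingType) (J : idealr R) (x : R) :
  (\pi_{ideal_quot J} x == 0) = (x \in J).
Proof. by rewrite -[x in RHS]subr0 Quotient.idealrBE rmorph0. Qed.

(** * Powers of [theta], cardinalities and the minimal ideal *)

Section ChainRing.

Variables (R : finComUnitRingType) (theta : R) (M : idealr R).
Hypothesis M_def : M =i principal theta.
Hypothesis M_unit : forall x, (x \in M) = (x \isn't a GRing.unit).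

Lemma annihilator_expr n r : theta ^+ n != 0 -> r * theta ^+ n = 0 -> r \in M.
Proof.
rewrite M_unit => th0 rth; apply: contraNN th0 => Ur.
by rewrite -(mulKr Ur (theta ^+ n)) rth mulr0.
Qed.

Lemma mul_expr_eq0 n r : theta ^+ n.+1 = 0 -> r \in M -> r * theta ^+ n = 0.
Proof.
by rewrite M_def => thn /principalP[s ->]; rewrite -mulrA -exprS thn mulr0.
Qed.

Variables (F : finFieldType) (psi : {rmorphism {ideal_quot M} -> F}).
Hypothesis psi_bij : bijective psi.

(** Each element of [principal (theta ^+ n)] is uniquely a residue class representative times
    [theta ^+ n] plus an element of [principal (theta ^+ n.+1)]; [f] below is this bijection. *)
Lemma card_principal_exprS n : theta ^+ n != 0 ->
  #|principal (theta ^+ n)| = (#|F| * #|principal (theta ^+ n.+1)|)%N.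
Proof.
move=> thn0; have [psiV psiK psiVK] := psi_bij.
pose f (u : F * R) : R := repr (psiV u.1) * theta ^+ n + u.2.
set D := setX [set: F] [set x in principal (theta ^+ n.+1)].
have f_inj : {in D &, injective f}.
  move=> [s x] [t y]; rewrite !inE => /principalP[r /= ->] /principalP[r' /= ->].
  rewrite /f /= => eq_f; have st : s = t.
    apply: (can_inj psiVK); rewrite -[psiV s]reprK -[psiV t]reprK.
    apply/eqP; rewrite -subr_eq0 -rmorphB pi_ideal_eq0.
    (* This element times [theta ^+ n] is the difference of the two values of [f], which is 0. *)
    have : repr (psiV s) - repr (psiV t) + (r - r') * theta \in M.
      apply: (@annihilator_expr n) => //.
      move/eqP: eq_f; rewrite -subr_eq0 exprS => /eqP.
      by apply: etrans; ring.
    by rewrite rpredDr // M_def mem_principal.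
  by move: eq_f; rewrite st => /addrI ->.
have -> : #|principal (theta ^+ n)| = #|f @: D|.
  apply: eq_card => x; apply/principalP/imsetP=> [[r ->] | [[s y]]].
    set s := repr (\pi_{ideal_quot M} r).
    have /principalP[t rs] : r - s \in principal theta.
      by rewrite -M_def Quotient.idealrBE reprK.
    exists (psi (\pi_{ideal_quot M} r), t * theta ^+ n.+1).
      by rewrite in_setX !in_set mem_principal.
    rewrite /f /= psiK -/s exprS mulrA -rs; ring.
  rewrite in_setX in_setT in_set /f => /principalP[r /= ->] ->.
  by exists (repr (psiV s) + r * theta); rewrite exprS; ring.
by rewrite card_in_imset // cardsX cardsT cardsE.
Qed.

Lemma card_principal_expr n : (forall i, (i < n)%N -> theta ^+ i != 0) ->
  #|R| = (#|F| ^ n * #|principal (theta ^+ n)|)%N.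
Proof.
elim: n => [_ | n IHn th0].
  rewrite mul1n; apply/esym/eq_card => x; rewrite !inE.
  by apply/existsP; exists x; rewrite mulr1.
rewrite IHn => [|i /ltnW/th0 //]; rewrite card_principal_exprS ?th0 //.
by rewrite mulnA -expnSr.
Qed.

Lemma card_principal0 : #|principal (0 : R)| = 1%N.
Proof.
rewrite -(card1 (0 : R)); apply: eq_card => x.
apply/principalP/eqP => [[r ->] | ->]; first by rewrite mulr0.
by exists 0; rewrite mulr0.
Qed.

Variable m : nat.
Hypothesis R_card : #|R| = (#|F| ^ m)%N.

(** If [i] were the first exponent with [theta ^+ i = 0], counting would give [#|R| = #|F| ^ i] with
    [i < m]. *)
Lemma expr_neq0 i : (i < m)%N -> theta ^+ i != 0.
Proof.
elim/ltn_ind: i => i IHi im; apply/eqP=> thi.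
have := card_principal_expr (fun j ji => IHi j ji (ltn_trans ji im)).
rewrite thi card_principal0 R_card muln1 => /eqP.
by rewrite eqn_exp2l ?card_finNzRing_gt1 // gtn_eqF.
Qed.

Lemma expr_eq0 : theta ^+ m = 0.
Proof.
have := card_principal_expr expr_neq0; rewrite R_card -{1}[(_ ^ _)%N]muln1.
move/eqP; rewrite eqn_pmul2l ?expn_gt0 ?(ltnW (card_finNzRing_gt1 _)) //.
rewrite eq_sym => /eqP card1.
have /card_le1_eqP le1 : (#|principal (theta ^+ m)| <= 1)%N by rewrite card1.
apply: le1; first by rewrite -(mul0r (theta ^+ m)) mem_principal.
by rewrite -[X in X \in _]mul1r mem_principal.
Qed.

(** [m = 0] gives [1 = 0]; [m = 1] gives [theta = 0], so every nonzero element is a unit. *)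
Lemma length_gt1 : ~ GRing.field_axiom R -> (2 <= m)%N.
Proof.
move=> nfield; case: (m) expr_eq0 => [/eqP | [th0 | //]].
  by rewrite oner_eq0.
case: nfield => x x0; apply: contraNT x0; rewrite -M_unit M_def.
by case/principalP=> r ->; rewrite -[theta]expr1 th0 mulr0.
Qed.

Hypothesis m_gt0 : (0 < m)%N.
Variable I : idealr R.
Hypothesis I_def : I =i principal (theta ^+ m.-1).

Let theta_m1_neq0 : theta ^+ m.-1 != 0.
Proof. by rewrite expr_neq0 // prednK. Qed.

Let theta_m1S_eq0 : theta ^+ m.-1.+1 = 0.
Proof. by rewrite prednK // expr_eq0. Qed.

(** Since [M] kills [theta ^+ m.-1], a nonzero [r * theta ^+ m.-1] has [r] a unit and therefore
    generates all of [I]. *)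
Lemma minimal_socle : minimal_ideal I.
Proof.
split=> [||K idK sKI].
- split=> [|c u v Iu Iv]; first exact: idealr0.
  by apply: rpredD => //; apply: idealMr.
- move/(_ (theta ^+ m.-1)); rewrite I_def -[X in X \in _]mul1r mem_principal.
  by rewrite inE (negPf theta_m1_neq0).
have [K0 _] := idK.
have [/existsP[x /andP[Kx x0]] | ] := boolP [exists x, (x \in K) && (x != 0)].
  right=> y; apply/idP/idP=> [/sKI // | ]; rewrite I_def => /principalP[s ->].
  have := sKI x Kx; rewrite I_def => /principalP[r xr].
  have Ur : r \is a GRing.unit.
    rewrite -[_ \is a _]negbK -M_unit; apply: contraNN x0 => Mr.
    by rewrite xr mul_expr_eq0.
  by rewrite -[theta ^+ _](mulKr Ur) -xr !is_idealMl.
rewrite negb_exists => /forallP K_triv; left=> x; rewrite inE.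
apply/idP/eqP => [Kx | -> //]; apply/eqP.
by have := K_triv x; rewrite Kx negbK.
Qed.

Lemma mul_socle_max x y : x \in I -> y \in M -> x * y = 0.
Proof.
rewrite I_def => /principalP[r ->] My.
by rewrite -mulrA [_ * y]mulrC mul_expr_eq0 ?mulr0.
Qed.

(** Together with [mul_socle_max] this yields [I * I = 0]. *)
Lemma socle_sub_max x : (1 < m)%N -> x \in I -> x \in M.
Proof.
move=> m_gt1; rewrite I_def M_def => /principalP[r ->].
have -> : m.-1 = m.-2.+1 by case: (m) m_gt1 => [|[]].
by rewrite exprSr mulrA mem_principal.
Qed.

Lemma socle_iso_exists : exists phi : R -> {ideal_quot M}, module_iso I phi.
Proof.
(* [phi] sends [r * theta ^+ m.-1] to the class of [r]. Any choice of [r] gives the same class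
   because the annihilator of [theta ^+ m.-1] lies in [M]; the value 0 is a default outside [I]. *)
pose phi (x : R) : {ideal_quot M} :=
  if [pick r | x == r * theta ^+ m.-1] is Some r then \pi r else 0.
have phiE r : phi (r * theta ^+ m.-1) = \pi r.
  rewrite /phi; case: pickP => [s /eqP rs | /(_ r)]; last by rewrite eqxx.
  apply/eqP; rewrite -subr_eq0 -rmorphB pi_ideal_eq0.
  by apply: annihilator_expr theta_m1_neq0 _; rewrite mulrBl rs subrr.
exists phi; split=> [x y | c x | x y | y].
- rewrite !I_def => /principalP[r ->] /principalP[s ->].
  by rewrite -mulrDl !phiE rmorphD.
- by rewrite I_def => /principalP[r ->]; rewrite mulrA !phiE rmorphM.
- rewrite !I_def => /principalP[r ->] /principalP[s ->].
  rewrite !phiE => /eqP; rewrite -subr_eq0 -rmorphB pi_ideal_eq0 => Mrs.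
  by apply/eqP; rewrite -subr_eq0 -mulrBl mul_expr_eq0.
- by exists (repr y * theta ^+ m.-1); rewrite ?phiE ?reprK // I_def mem_principal.
Qed.

End ChainRing.

(** * Dependence of the system on [w] *)

Section LinearForms.

Variables (R : comNzRingType) (k : nat).
Implicit Types (f g : k.-tuple R -> R) (v w : k.-tuple R).

Definition linear_form f : Prop :=
  exists L : 'I_k -> R, forall w, f w = \sum_(i < k) L i * w`_i.

Lemma linear_form_nth n : linear_form (fun w => w`_n).
Proof.
have [kn | nk] := leqP k n.
  exists (fun=> 0) => w; rewrite nth_default ?size_tuple // big1 // => i _.
  exact: mul0r.
exists (fun i => (i == Ordinal nk)%:R) => w.
rewrite (bigD1 (Ordinal nk)) //= eqxx mul1r big1 ?addr0 // => i /negPf ->.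
exact: mul0r.
Qed.

Lemma linear_formD f g :
  linear_form f -> linear_form g -> linear_form (fun w => f w + g w).
Proof.
move=> [L fL] [K gK]; exists (fun i => L i + K i) => w.
by rewrite fL gK -big_split; apply: eq_bigr => i _; rewrite mulrDl.
Qed.

Lemma linear_formZ c f : linear_form f -> linear_form (fun w => c * f w).
Proof.
move=> [L fL]; exists (fun i => c * L i) => w.
by rewrite fL mulr_sumr; apply: eq_bigr => i _; rewrite mulrA.
Qed.

Lemma linear_form_sum (T : Type) (r : seq T) (F : T -> k.-tuple R -> R) :
  (forall i, linear_form (F i)) -> linear_form (fun w => \sum_(i <- r) F i w).
Proof.
move=> linF; elim: r => [|i r [L sumL]].
  by exists (fun=> 0) => w; rewrite big_nil big1 // => i _; rewrite mul0r.
have [K FiK] := linF i; exists (fun l => K l + L l) => w.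
by rewrite big_cons FiK sumL -big_split; apply: eq_bigr => l _; rewrite mulrDl.
Qed.

Variable alpha : R.

(** The closure properties of linear forms give the coefficients without collecting the shifted
    indices explicitly; they do not depend on [w]. *)
Lemma sys_rhs_affine v j : exists L : 'I_k -> R,
  forall w, sys_rhs alpha v w j = sys_const alpha v j + \sum_(i < k) L i * w`_i.
Proof.
rewrite /sys_rhs; case: eqP => [-> | _].
  suff [L fL] : linear_form (fun w => 2%:R * \sum_(0 <= i < k) v`_i * w`_i).
    by exists L => w; rewrite fL.
  apply/linear_formZ/linear_form_sum => i; exact/linear_formZ/linear_form_nth.
suff [L fL] : linear_form (fun w =>
    \sum_(0 <= i < j) (alpha * v`_i * w`_(k - j + i)
                       + alpha * v`_(k - j + i) * w`_i)
    + \sum_(j <= i < k) (v`_i * w`_(i - j) + v`_(i - j) * w`_i)).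
  by exists L => w; rewrite -fL addrA.
by apply: linear_formD; apply: linear_form_sum => i; apply: linear_formD;
  apply/linear_formZ/linear_form_nth.
Qed.

Definition add_tuple v w : k.-tuple R := [tuple of mkseq (fun i => v`_i + w`_i) k].

Lemma nth_add_tuple v w i : (add_tuple v w)`_i = v`_i + w`_i.
Proof.
have [ik | ki] := ltnP i k; first by rewrite nth_mkseq.
by rewrite !nth_default ?size_tuple ?addr0.
Qed.

Lemma circD v w : circ alpha v + circ alpha w = circ alpha (add_tuple v w).
Proof.
apply/matrixP=> i j; rewrite !mxE !nth_add_tuple.
by case: ifP => // _; rewrite mulrDr.
Qed.

(** Expanding the products for [v + w] leaves, besides the constant and the linear terms, only
    multiples of products of two entries of [w]. *)
Lemma sys_const_add v w j : (forall i l, w`_i * w`_l = 0) ->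
  sys_const alpha (add_tuple v w) j = sys_rhs alpha v w j.
Proof.
move=> w2; rewrite /sys_rhs /sys_const; case: eqP => _.
  rewrite -addrA; congr (_ + _); rewrite mulr_sumr -big_split.
  apply: eq_bigr => i _; rewrite nth_add_tuple /=.
  by ring: (w2 i i).
rewrite -[RHS]addrA [RHS]addrACA -!big_split.
congr (_ + _); apply: eq_bigr => i _; rewrite !nth_add_tuple /=.
  ring: (w2 i (k - j + i)%N).
ring: (w2 i (i - j)%N).
Qed.

End LinearForms.

(** * Reduction modulo [I] and the proof of the theorem *)

Lemma rmorph_sys_const (R S : comNzRingType) (f : {rmorphism R -> S}) k
    (alpha : R) (v : k.-tuple R) (u : k.-tuple S) j :
  (forall i, u`_i = f v`_i) -> sys_const (f alpha) u j = f (sys_const alpha v j).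
Proof.
move=> uv; rewrite /sys_const; case: eqP => _; rewrite rmorphD !rmorph_sum ?rmorph1;
  congr (_ + _); apply: eq_bigr => i _; by rewrite !uv !rmorphM.
Qed.

Lemma map_circ (R S : comNzRingType) (f : {rmorphism R -> S}) k
    (alpha : R) (v : k.-tuple R) (u : k.-tuple S) :
  (forall i, u`_i = f v`_i) -> map_mx f (circ alpha v) = circ (f alpha) u.
Proof.
move=> uv; apply/matrixP=> i j; rewrite !mxE !uv.
by case: ifP => // _; rewrite rmorphM.
Qed.

Theorem mainTheorem1
    (R : finComUnitRingType) (R_chain : chain_ring R)
    (R_not_field : ~ GRing.field_axiom R)
    (theta : R) (theta_max : maximal_ideal (principal theta))
    (M : idealr R) (M_def : M =i principal theta)
    (q m : nat) (F : finFieldType) (F_card : #|F| = q)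
    (psi : {rmorphism {ideal_quot M} -> F}) (psi_iso : bijective psi)
    (R_card : #|R| = (q ^ m)%N)
    (I : idealr R) (I_def : I =i principal (theta ^+ (m - 1)))
    (alpha : R) (alpha2 : alpha ^+ 2 = 1)
    (k : nat) (k_gt0 : (0 < k)%N)
    (e : {ideal_quot I} -> R)
    (e_repr : forall x : {ideal_quot I}, \pi_{ideal_quot I} (e x) = x)
    (e_alpha : e (\pi_{ideal_quot I} alpha) = alpha)
    (a : k.-tuple {ideal_quot I})
    (A_sd : self_dual (code_gen (row_mx 1%:M (circ (\pi_{ideal_quot I} alpha) a)))) :
  let A : 'M[{ideal_quot I}]_k := circ (\pi_{ideal_quot I} alpha) a in
  let ea : k.-tuple R := map_tuple e a in
  let c : nat -> R := sys_const alpha ea in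
  let h : nat := k./2 in
  [/\ (2 <= m)%N,
      minimal_ideal I,
      forall j, (j <= h)%N -> c j \in I,
      forall w : k.-tuple R, {subset w <= I} ->
        let B := circ alpha ea + circ alpha w in
        is_lift alpha A B /\
        (self_dual (code_gen (row_mx 1%:M B)) <-> sys_holds alpha ea w)
    & (exists phi : R -> {ideal_quot M}, module_iso I phi) /\
      exists L : 'M[R]_(h.+1, k),
        (forall (w : k.-tuple R) (j : 'I_h.+1),
          sys_rhs alpha ea w j = c j + \sum_(i < k) L j i * w`_i) /\
        (forall phi : R -> {ideal_quot M}, module_iso I phi ->
          forall w : k.-tuple R, {subset w <= I} ->
            (sys_holds alpha ea w <->
             0 = (\col_(j < h.+1) psi (phi (c j)))
                 + map_mx (fun r : R => psi (\pi_{ideal_quot M} r)) L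
                   *m (\col_(i < k) psi (phi w`_i))))].
Proof.
move=> A ea c h.
have M_unit x : (x \in M) = (x \isn't a GRing.unit).
  by rewrite M_def (mem_maximal_ideal _ R_chain theta_max).
have R_card' : #|R| = (#|F| ^ m)%N by rewrite F_card.
have m_gt1 : (1 < m)%N := length_gt1 M_def M_unit psi_iso R_card' R_not_field.
have m_gt0 : (0 < m)%N by apply: ltnW.
have I_def' : I =i principal (theta ^+ m.-1) by rewrite -subn1.
have minI := minimal_socle M_def M_unit psi_iso R_card' m_gt0 I_def'.
have eaE i : a`_i = \pi_{ideal_quot I} ea`_i.
  have [ik | ki] := ltnP i k; first by rewrite (nth_map 0) ?size_tuple.
  by rewrite !nth_default ?size_tuple ?rmorph0.
have alpha2_pi : \pi_{ideal_quot I} alpha ^+ 2 = 1.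
  by rewrite -rmorphXn alpha2 rmorph1.
(* The class of [c j] is the constant of the system for [a] over the quotient by [I], which vanishes
   by self-duality there. *)
have cI j : (j <= h)%N -> c j \in I.
  move=> jh; rewrite -pi_ideal_eq0 -(rmorph_sys_const _ _ eaE).
  by move/(self_dual_circ a alpha2_pi k_gt0): A_sd => ->.
have nthI (w : k.-tuple R) i : {subset w <= I} -> w`_i \in I.
  move=> wI; have [ik | ki] := ltnP i k; first by rewrite wI ?mem_nth ?size_tuple.
  by rewrite nth_default ?size_tuple ?idealr0.
split=> // [w wI B | ].
  have BE : B = circ alpha (add_tuple ea w) by apply: circD.
  split; first split.
  - by exists (add_tuple ea w).
  - rewrite BE; apply: map_circ => i.
    rewrite nth_add_tuple rmorphD /= -eaE.
    suff /eqP -> : \pi_{ideal_quot I} w`_i == 0 by rewrite addr0.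
    by rewrite pi_ideal_eq0 nthI.
  have w2 i l : w`_i * w`_l = 0.
    rewrite (mul_socle_max M_def M_unit psi_iso R_card' m_gt0 I_def') ?nthI //.
    by rewrite (socle_sub_max M_def I_def') ?nthI.
  rewrite BE self_dual_circ //.
  by split=> H j jh; have := H j jh; rewrite sys_const_add.
split; first exact: (socle_iso_exists M_def M_unit psi_iso R_card' m_gt0 I_def').
(* The rows of coefficients are fixed before [phi], so one matrix serves every isomorphism. *)
have [L LE] := fin_all_exists (fun j : 'I_h.+1 => sys_rhs_affine alpha ea j).
exists (\matrix_(j, i) L j i); split=> [w j | phi [phiD phiZ phi_inj _] w wI].
  by rewrite LE; congr (_ + _); apply: eq_bigr => i _; rewrite mxE.
have I0 : 0 \in I by apply: idealr0.
have phi0 : phi 0 = 0 by rewrite -(mul0r 0) phiZ // rmorph0 mul0r.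
have phi_sum (f : 'I_k -> R) : (forall i, f i \in I) ->
    phi (\sum_(i < k) f i) = \sum_(i < k) phi (f i).
  (* [phi] is additive only on [I], so membership in [I] is carried along the induction on the
     sum. *)
  move=> fI; pose P x y := x \in I /\ phi x = y.
  suff [] : P (\sum_(i < k) f i) (\sum_(i < k) phi (f i)) by [].
  apply: big_ind2 => // x1 x2 y1 y2 [I1 <-] [I2 <-].
  by split; [apply: rpredD | apply: phiD].
have LwI j i : L j i * w`_i \in I by rewrite idealMr ?nthI.
have rhsI (j : 'I_h.+1) : sys_rhs alpha ea w j \in I.
  by rewrite LE rpredD ?rpred_sum // cI // -ltnS.
(* Applying [psi] after [phi] turns equation [j] over [R] into row [j] of the system over [F]: [phi]
   is linear on [I], with scalars acting through their classes modulo [M]. *)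
have rhs_phi (j : 'I_h.+1) : psi (phi (sys_rhs alpha ea w j)) =
    ((\col_(j < h.+1) psi (phi (c j)))
     + map_mx (fun r : R => psi (\pi_{ideal_quot M} r)) (\matrix_(j, i) L j i)
       *m (\col_(i < k) psi (phi w`_i))) j 0.
  rewrite LE phiD ?rpred_sum ?cI ?phi_sum // -1?ltnS // rmorphD rmorph_sum !mxE.
  congr (_ + _); apply: eq_bigr => i _.
  by rewrite !mxE phiZ ?nthI // rmorphM.
split=> [H | H j jh].
  apply/colP=> j; rewrite -rhs_phi -H; last by rewrite -ltnS.
  by rewrite phi0 rmorph0 mxE.
have := rhs_phi (Ordinal (jh : j < h.+1)%N); rewrite -H mxE /= => psi_phi0.
(* Zero is reflected back because both sides lie in [I], where [phi] is injective, and [psi] is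
   bijective. *)
apply: phi_inj; rewrite ?(rhsI (Ordinal (jh : j < h.+1)%N)) //.
by apply: (bij_inj psi_iso); rewrite psi_phi0 phi0 rmorph0.
Qed.
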